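(* Let $\mathcal{P}\in\mathcal{Q}_n$ be an irreducible, combinatorially symmetric sign pattern with a $0$-diagonal, and let $G$ be its signed undirected graph. If $G$ contains two leaves $u$ and $v$ with a common neighbour $w$, then $\mathcal{P}$ is consistent only if the edges $\{u,w\}$ and $\{v,w\}$ have the same sign.
   Context: A sign pattern is a matrix with entries in $\{+,-,0\}$; $\mathcal{Q}_n$ is the set of $n\times n$ sign patterns; $\mathcal{Q}(\mathcal{P})$ is the set of real matrices whose entries have the signs prescribed by $\mathcal{P}=[p_{ij}]$. $\mathcal{P}$ is combinatorially symmetric if $p_{ij}\neq0\iff p_{ji}\ne0$; $0$-diagonal means $p_{ii}=0$ for all $i$. Its signed undirected graph $G$ has vertices $1,\dots,n$, an edge $\{i,j\}$ ($i\neq j$) iff $p_{ij}\ne0$, and the edge is signed $p_{ij}p_{ji}$. A leaf is a vertex of degree one. $\mathcal{P}$ is consistent if there is $k$ such that every $A\in\mathcal{Q}(\mathcal{P})$ has exactly $k$ real eigenvalues (with algebraic multiplicity). *)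

(* Defs.v *)
From HB Require Import structures.
From mathcomp Require Import all_boot all_order all_algebra all_fingroup.
From mathcomp Require Import reals.
From mathcomp Require Import polyrcf.

Set Implicit Arguments.
Unset Strict Implicit.
Unset Printing Implicit Defensive.

Import Order.TTheory GRing.Theory Num.Theory.
Local Open Scope ring_scope.

Inductive sign := Plus | Minus | Zero.

Definition option_of_sign (s : sign) : option bool :=
  match s with Plus => Some true | Minus => Some false | Zero => None end.
Definition sign_of_option (o : option bool) : sign :=
  match o with Some true => Plus | Some false => Minus | None => Zero end.
Lemma option_of_signK : cancel option_of_sign sign_of_option.
Proof. by case. Qed.
HB.instance Definition _ := Equality.copy sign (can_type option_of_signK).

Definition sign_mul (s t : sign) : sign :=
  match s, t with
  | Zero, _ | _, Zero => Zero
  | Plus, Plus | Minus, Minus => Plus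
  | Plus, Minus | Minus, Plus => Minus
  end.

Definition sign_of (R : realType) (x : R) : sign :=
  if 0 < x then Plus else if x < 0 then Minus else Zero.

Definition sign_pattern (n : nat) := 'M[sign]_n.

Definition qualitative_class (R : realType) (n : nat) (P : sign_pattern n)
    (A : 'M[R]_n) : Prop :=
  map_mx (@sign_of R) A = P.

Definition combinatorially_symmetric (n : nat) (P : sign_pattern n) : Prop :=
  forall i j, P i j <> Zero <-> P j i <> Zero.

Definition zero_diagonal (n : nat) (P : sign_pattern n) : Prop :=
  forall i, P i i = Zero.

(* [P] is reducible when a simultaneous permutation of its rows and columns
   gives it a zero lower-left block, of size [(n - k) x k] with [0 < k < n],
   below two square diagonal blocks of orders [k] and [n - k]. *)
Definition reducible (n : nat) (P : sign_pattern n) : Prop :=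
  exists (s : 'S_n) (k : nat), (0 < k < n)%N /\
    forall i j : 'I_n, (k <= i)%N -> (j < k)%N ->
      row_perm s (col_perm s P) i j = Zero.

Definition irreducible (n : nat) (P : sign_pattern n) : Prop := ~ reducible P.

(* Only meant for combinatorially symmetric [P], for which it is symmetric. *)
Definition edge (n : nat) (P : sign_pattern n) : rel 'I_n :=
  fun i j => (i != j) && (P i j != Zero).

Definition edge_sign (n : nat) (P : sign_pattern n) (i j : 'I_n) : sign :=
  sign_mul (P i j) (P j i).

Definition degree (n : nat) (P : sign_pattern n) (i : 'I_n) : nat :=
  #|[set j | edge P i j]|.

Definition leaf (n : nat) (P : sign_pattern n) (i : 'I_n) : Prop :=
  degree P i = 1%N.

(* [rootsR p] lists the distinct real roots of [p], and [mup x p] is the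
   multiplicity of [x] as a root of [p]. *)
Definition real_eigenvalue_count (R : realType) (n : nat) (A : 'M[R]_n) : nat :=
  (\sum_(x <- rootsR (char_poly A)) mup x (char_poly A))%N.

Definition consistent (R : realType) (n : nat) (P : sign_pattern n) : Prop :=
  exists k : nat, forall A : 'M[R]_n,
    qualitative_class P A -> real_eigenvalue_count A = k.

(* Main.v *)
(* Suppose [{u,w}] is positive and [{v,w}] negative, let [B] be [A] without [u, v] and [C]
   be [B] without [w].  Then [phi_A = X (X phi_B - c phi_C)], where
   [c = a_uw a_wu + a_vw a_wv] can be any real number.  Since the pattern is
   combinatorially symmetric, [C] can be chosen with [phi_C = X^j psi], [psi(0) <> 0]
   and rank [m - j]; scaling the row from [w] to [C] by [e], ranks force
   [phi_A = X^(j+1) ((X^2 - c) psi - e q)] for a fixed [q].  For small [e > 0] the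
   function [x^2 - e q(x)/psi(x)] has a local minimum near [0], so real roots appear as
   [c] increases through that minimum, and the number of real eigenvalues varies. *)
Require Import Defs.
From mathcomp Require Import all_boot all_order all_algebra all_fingroup.
From mathcomp Require Import reals.
From mathcomp Require Import boolp classical_sets functions topology.
From mathcomp Require Import normedtype derive realfun polyrcf.
From mathcomp Require Import ring lra zify.

Set Implicit Arguments.
Unset Strict Implicit.
Unset Printing Implicit Defensive.

Import Order.TTheory GRing.Theory Num.Theory.
Import numFieldTopology.Exports numFieldNormedType.Exports.
Local Open Scope ring_scope.

(** * Ranks and characteristic polynomials *)

(** In the full-rank factorization of [A], the column basis has a left inverse and the row basis a
    right inverse. A rank bound thereby becomes the nonvanishing of one determinant, a polynomial
    condition along a pencil. *)
Lemma rank_retraction (F : fieldType) m n (A : 'M[F]_(m, n)) :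
  exists L U, L *m A *m U = 1%:M :> 'M_(\rank A).
Proof.
exists (pinvmx (col_base A)), (pinvmx (row_base A)).
rewrite -[X in _ *m X *m _](mulmx_base A) mulmxA mulVpmx ?col_base_full // mul1mx.
by rewrite mulmxVp ?row_base_free.
Qed.

Lemma unit_mulmx_rank (F : fieldType) r m n (L : 'M[F]_(r, m)) (A : 'M_(m, n)) U :
  L *m A *m U \in unitmx -> (r <= \rank A)%N.
Proof.
rewrite -row_free_unit => /eqP {1}<-.
by apply: leq_trans (mxrankM_maxl _ _) _; apply: mxrankM_maxr.
Qed.

(** With [L *m B *m U = 1], the determinant of [L *m (A + t *: B) *m U] is the characteristic
    polynomial of [- (L *m A *m U)] at [t], and it is monic. *)
Lemma rank_pencilr (F : fieldType) m n (A B : 'M[F]_(m, n)) :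
  exists2 g : {poly F}, g != 0 &
    forall t, g.[t] != 0 -> (\rank B <= \rank (A + t *: B)%R)%N.
Proof.
have [L [U LBU]] := rank_retraction B.
exists (char_poly (- (L *m A *m U))) => [|t gt0].
  by rewrite monic_neq0 ?char_poly_monic.
apply: (unit_mulmx_rank (L := L) (U := U)).
rewrite unitmxE unitfE; apply: contraNneq gt0 => dt0.
rewrite -/(horner_eval t _) -det_map_mx -{}dt0; apply/eqP; congr (\det _).
rewrite mulmxDr mulmxDl -scalemxAr -scalemxAl LBU addrC.
apply/matrixP=> i j; rewrite !mxE /= horner_evalE hornerD hornerN hornerMn.
by rewrite hornerX hornerC opprK mulr_natr.
Qed.

(** Here the determinant of the compressed pencil is a polynomial in [t] with value 1 at 0. *)
Lemma rank_pencill (F : fieldType) m n (A B : 'M[F]_(m, n)) :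
  exists2 g : {poly F}, g != 0 &
    forall t, g.[t] != 0 -> (\rank A <= \rank (A + t *: B)%R)%N.
Proof.
have [L [U LAU]] := rank_retraction A.
pose M := map_mx polyC (L *m A *m U) + 'X *: map_mx polyC (L *m B *m U).
have gE t : (\det M).[t] = \det (L *m (A + t *: B) *m U).
  rewrite -/(horner_eval t _) -det_map_mx; congr (\det _).
  rewrite mulmxDr mulmxDl -scalemxAr -scalemxAl.
  apply/matrixP=> i j; rewrite !mxE /horner_eval /=.
  by rewrite /= horner_evalE !hornerE.
exists (\det M) => [|t gt0].
  apply: contra_neq (oner_neq0 F) => M0.
  by rewrite -[RHS](horner0 0) -M0 gE scale0r addr0 LAU det1.
by apply: (unit_mulmx_rank (L := L) (U := U)); rewrite unitmxE unitfE -gE.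
Qed.

Lemma coef_char_poly_pencil (F : fieldType) n (A B : 'M[F]_n) i :
  exists g : {poly F}, forall t, g.[t] = (char_poly (A + t *: B))`_i.
Proof.
pose M := map_mx polyC A + 'X *: map_mx polyC B.
exists (char_poly M)`_i => t.
rewrite -/(horner_eval t _) -coef_map map_char_poly; congr (char_poly _)`_i.
by apply/matrixP=> j k; rewrite !mxE /= horner_evalE !hornerE.
Qed.

Lemma exists_gt_nonroot (R : realFieldType) (g : {poly R}) (b : R) :
  g != 0 -> exists2 t, b < t & g.[t] != 0.
Proof.
move=> g0; pose s := [seq b + i.+1%:R | i <- iota 0 (size g)].
have us : uniq s.
  rewrite map_inj_uniq ?iota_uniq // => i j /addrI /eqP.
  by rewrite eqr_nat => /eqP [].
have := contra_leqN (fun h => max_poly_roots g0 h us).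
rewrite size_map size_iota leqnn => /(_ isT) /allPn[x /mapP[i _ ->]] rx.
by exists (b + i.+1%:R); rewrite ?ltrDl ?ltr0n.
Qed.

(** Two block eliminations compute the determinant of the same [M]: one clears [B'] and leaves
    ['X - A' *m B'], the other clears [A'] at the cost of a factor ['X^n] and leaves
    ['X - B' *m A']. *)
Lemma char_poly_mulmxC (R : comNzRingType) m n (A : 'M[R]_(m, n)) (B : 'M_(n, m)) :
  'X^n * char_poly (A *m B) = 'X^m * char_poly (B *m A).
Proof.
pose A' := map_mx polyC A; pose B' := map_mx polyC B.
pose M := block_mx 'X%:M A' B' 1%:M.
have detM : \det M = char_poly (A *m B).
  have: M *m block_mx 1%:M 0 (- B') 1%:M = block_mx ('X%:M - A' *m B') A' 0 1%:M.
    by rewrite mulmx_block !mulmx1 !mul1mx !mulmx0 mulmxN subrr !add0r.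
  move=> /(congr1 determinant).
  rewrite det_mulmx det_lblock det_ublock !det1 !mulr1 => ->.
  by rewrite /char_poly /char_poly_mx map_mxM.
have: M *m block_mx 1%:M (- A') 0 'X%:M
    = block_mx 'X%:M 0 B' ('X%:M - B' *m A').
  rewrite mulmx_block !mulmx1 !mul1mx !mulmx0 !addr0 !mulmxN addrC.
  by rewrite mul_scalar_mx mul_mx_scalar subrr addrC.
move=> /(congr1 determinant).
rewrite det_mulmx detM det_ublock det_lblock det1 mul1r !det_scalar mulrC => ->.
by rewrite /char_poly /char_poly_mx map_mxM.
Qed.

(** Swapping the factors of a full-rank factorization gives a matrix of order [\rank A], and the
    remaining degree is a power of ['X]. *)
Lemma dvdp_Xn_char_poly (F : fieldType) n (A : 'M[F]_n) :
  'X^(n - \rank A) %| char_poly A.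
Proof.
have := char_poly_mulmxC (col_base A) (row_base A).
rewrite mulmx_base => /(congr1 (fun p => 'X^(n - \rank A) * p)).
rewrite mulrA -exprD subnK ?rank_leq_row // mulrCA.
by move=> /mulfI ->; rewrite ?dvdp_mulr // monic_neq0 ?monicXn.
Qed.

(* [E] selects rows of [A] forming a basis of its row space; [E *m E^T] is then
   the coordinate projection onto their indices. *)
Lemma exists_row_basis_selection (F : fieldType) m n (A : 'M[F]_(m, n)) :
  exists E : 'M[F]_(m, \rank A),
    [/\ E^T *m E = 1%:M, is_diag_mx (E *m E^T) & \rank (E^T *m A) = \rank A].
Proof.
have f_inj : injective (maxrankfun A) by exact: maxrankfun_inj.
exists (rowsub (maxrankfun A) 1%:M)^T; rewrite trmxK; split.
- apply/matrixP => i j; rewrite !mxE (bigD1 (maxrankfun A i)) //= !mxE eqxx.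
  rewrite mul1r big1 ?addr0 => [|k ki]; first by rewrite (inj_eq f_inj) eq_sym.
  by rewrite !mxE eq_sym (negPf ki) mul0r.
- apply/is_diag_mxP => i j ij; rewrite !mxE big1 // => k _; rewrite !mxE.
  have [->|_] := eqVneq (maxrankfun A k) i; last by rewrite mul0r.
  by rewrite -val_eqE (negPf ij) mulr0.
- by rewrite -rowsubE; apply/eqP/maxrowsub_free.
Qed.

(** * Real matrices supported on a sign pattern *)

Definition sgn_val (R : pzRingType) (s : sign) : R :=
  match s with Plus => 1 | Minus => -1 | Zero => 0 end.

Lemma sign_of_gt0 (R : realType) (x : R) : 0 < x -> sign_of x = Plus.
Proof. by rewrite /sign_of => ->. Qed.

Lemma sign_of_lt0 (R : realType) (x : R) : x < 0 -> sign_of x = Minus.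
Proof. by move=> x0; rewrite /sign_of x0 ltNge (ltW x0). Qed.

Lemma sign_of0 (R : realType) : sign_of (0 : R) = Zero.
Proof. by rewrite /sign_of ltxx. Qed.

Lemma sign_of_mul_sgn_val (R : realType) (x : R) s : 0 < x -> sign_of (x * sgn_val R s) = s.
Proof.
case: s => x0 /=; first by rewrite mulr1 sign_of_gt0.
  by rewrite mulrN1 sign_of_lt0 // oppr_lt0.
by rewrite mulr0 sign_of0.
Qed.

(** Unlike the qualitative class, this is a linear subspace: ranks can be maximized over it and
    pencils stay inside it. *)
Definition supported (R : realType) n (P : sign_pattern n) (A : 'M[R]_n) :=
  forall i j, P i j = Zero -> A i j = 0.

Lemma qualitative_class_supported (R : realType) n (P : sign_pattern n) (A : 'M[R]_n) :
  qualitative_class P A -> supported P A.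
Proof.
move=> <- i j; rewrite mxE /sign_of.
by case: ltP => // x0; case: ltP => // x1 _; apply/le_anti; rewrite x0.
Qed.

Lemma supportedD (R : realType) n (P : sign_pattern n) (A B : 'M[R]_n) :
  supported P A -> supported P B -> supported P (A + B).
Proof. by move=> sA sB i j P0; rewrite mxE sA ?sB ?addr0. Qed.

Lemma supportedZ (R : realType) n (P : sign_pattern n) a (A : 'M[R]_n) :
  supported P A -> supported P (a *: A).
Proof. by move=> sA i j P0; rewrite mxE sA ?mulr0. Qed.

Lemma supported_tr (R : realType) n (P : sign_pattern n) (A : 'M[R]_n) :
  combinatorially_symmetric P -> supported P A -> supported P A^T.
Proof.
move=> Psym sA i j P0; rewrite mxE sA //; apply/eqP/negP => /negP/eqP.
by move=> /Psym; rewrite P0.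
Qed.

Lemma supported_mul_diag (R : realType) n (P : sign_pattern n) (Y A : 'M[R]_n) :
  is_diag_mx Y -> supported P A -> supported P (Y *m A *m Y).
Proof.
move=> /diag_mxP[d ->] sA i j P0.
by rewrite mul_mx_diag mxE mul_diag_mx mxE sA // mulr0 mul0r.
Qed.

(** Once [s] exceeds every [|Z i j|], the sign matrix dictates all signs. The multiple is large
    rather than small, so [s] can be any large nonroot of a given polynomial. *)
Lemma qualitative_class_perturb (R : realType) n (P : sign_pattern n) (Z : 'M[R]_n) s :
  supported P Z -> \sum_i \sum_j `|Z i j| < s ->
  qualitative_class P (Z + s *: map_mx (sgn_val R) P).
Proof.
move=> sZ ltZs; apply/matrixP => i j; rewrite !mxE.
have {ltZs} : `|Z i j| < s.
  apply: le_lt_trans ltZs; rewrite (bigD1 i) //= (bigD1 j) //= -addrA lerDl.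
  by rewrite addr_ge0 // ?sumr_ge0 // => k _; rewrite sumr_ge0.
rewrite ltr_norml => /andP[lZ Zl]; case E: (P i j) => /=.
- by rewrite sign_of_gt0 // mulr1 -ltrBlDr sub0r.
- by rewrite sign_of_lt0 // mulrN1 subr_lt0.
- by rewrite mulr0 addr0 sZ // sign_of0.
Qed.

(* A supported [D] of maximal rank [r] has independent rows at some index set [K];
   as [D^T] is supported too, a generic [D + t D^T] has independent rows and columns
   at [K], so its principal [K]-block is invertible and the coefficient of degree
   [n - r] is not identically zero on supported matrices. *)
Lemma exists_semisimple_zero (R : realType) n (P : sign_pattern n) :
  combinatorially_symmetric P ->
  exists2 C : 'M[R]_n, qualitative_class P C &
    (char_poly C)`_(n - \rank C) != 0.
Proof.
move=> Psym.
pose attained r := `[< exists2 D : 'M[R]_n, supported P D & \rank D = r >].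
have ex_r : exists r, attained r.
  by exists (\rank (0 : 'M[R]_n)); apply/asboolP; exists 0 => // i j _; rewrite mxE.
have le_r r : attained r -> (r <= n)%N.
  by move=> /asboolP[D _ <-]; apply: rank_leq_row.
case: (ex_maxnP ex_r le_r) => r /asboolP[D sD rD] max_r.
have {}max_r (A : 'M[R]_n) : supported P A -> (\rank A <= r)%N.
  by move=> sA; apply/max_r/asboolP; exists A.
have [E [EE diagE rED]] := exists_row_basis_selection D.
have [g1 g10 rk1] := rank_pencill (E^T *m D) (E^T *m D^T).
have [g2 g20 rk2] := rank_pencilr (D *m E) (D^T *m E).
have [t _] := exists_gt_nonroot 0 (mulf_neq0 g10 g20).
rewrite hornerM mulf_eq0 negb_or => /andP[/rk1 + /rk2].
rewrite !scalemxAl -mulmxDl -{1}scalemxAl scalemxAr -mulmxDr.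
rewrite rED -[\rank (D^T *m E)]mxrank_tr trmx_mul trmxK rED.
set Dt := D + t *: D^T => rk_row rk_col.
have sDt : supported P Dt by apply/supportedD/supportedZ/supported_tr.
pose N := E^T *m Dt *m E; pose Z := E *m E^T *m Dt *m (E *m E^T).
have sZ : supported P Z by apply: supported_mul_diag.
(* Frobenius' inequality: the ranks of [E^T *m Dt] and [Dt *m E], both at least [r], add up to at
   most [\rank Dt + \rank N], where [\rank Dt <= r]. *)
have uN : N \in unitmx.
  rewrite -row_free_unit /row_free eqn_leq rank_leq_row /=.
  rewrite -(leq_add2l (\rank D)) [X in (_ <= X + _)%N]rD.
  apply: leq_trans (leq_add rk_row rk_col) _.
  apply: leq_trans (mxrank_Frobenius _ _ _) _.
  by rewrite leq_add2r max_r.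
(* Swapping [E] to the other side turns [Z] into [N], so this coefficient is the constant one of
   [char_poly N], that is [\det N] up to sign. *)
have coefZ : (char_poly Z)`_(n - r) != 0.
  have ZE : Z = E *m (E^T *m Dt *m (E *m E^T)) by rewrite /Z !mulmxA.
  have NE : N = E^T *m Dt *m (E *m E^T) *m E by rewrite /N -!mulmxA EE mulmx1.
  have := char_poly_mulmxC E (E^T *m Dt *m (E *m E^T)).
  rewrite -ZE -NE => /(congr1 (fun p : {poly R} => p`_n)).
  rewrite coefXnM coefXnM ltnn subnn ltnNge rank_leq_row /= -{1}rD => ->.
  rewrite char_poly_det mulf_neq0 ?signr_eq0 // -unitfE -unitmxE //.
have [g gE] := coef_char_poly_pencil Z (map_mx (sgn_val R) P) (n - r).
have g0 : g != 0.
  by apply: contraNneq coefZ => g0; have := gE 0; rewrite g0 horner0 scale0r addr0 => <-.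
have [s ltZs gs] := exists_gt_nonroot (\sum_i \sum_j `|Z i j|) g0.
have qC := qualitative_class_perturb sZ ltZs.
exists (Z + s *: map_mx (sgn_val R) P) => //.
have rC := max_r _ (qualitative_class_supported qC).
suff -> : \rank (Z + s *: map_mx (sgn_val R) P)%R = r by rewrite -gE.
apply/eqP; rewrite eqn_leq rC /=.
(* A rank below [r] would make a power of ['X] beyond [n - r] divide the characteristic polynomial,
   killing the coefficient of degree [n - r]. *)
have := dvdp_Xn_char_poly (Z + s *: map_mx (sgn_val R) P).
rewrite leqNgt => /dvdpP[p pE]; apply: contra gs => ltr.
by rewrite gE pE coefMXn ltn_sub2l // (leq_trans ltr) // -rD rank_leq_row.
Qed.

(** * Real roots counted with multiplicity *)

Lemma mup_prod_XsubC (F : fieldType) (g : {poly F}) s x :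
  ~~ root g x -> mup x (g * \prod_(y <- s) ('X - y%:P)) = count_mem x s.
Proof.
move=> gx; have g0 : g != 0 by apply: contraNneq gx => ->; rewrite root0.
rewrite mupMr //; elim: s => [|y s IHs]; first by rewrite big_nil mupNroot ?root1.
rewrite big_cons /=; have [->|yx] := eqVneq y x; last first.
  by rewrite add0n mupMr // root_XsubC eq_sym.
have p0 : \prod_(z <- s) ('X - z%:P) != 0 :> {poly F} by rewrite monic_neq0 ?monic_prod_XsubC.
have pX0 : 'X - x%:P != 0 by rewrite polyXsubC_eq0.
apply/eqP; rewrite add1n eqn_leq; apply/andP; split.
  by rewrite -ltnS mup_ltn ?mulf_neq0 // exprS dvdp_mul2l // -mup_ltn // IHs.
by rewrite mup_geq ?mulf_neq0 // exprS dvdp_mul2l // -mup_geq // IHs.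
Qed.

Definition real_root_count (R : rcfType) (p : {poly R}) : nat :=
  (\sum_(x <- rootsR p) mup x p)%N.

Lemma mem_rootsR (R : rcfType) (p : {poly R}) x : p != 0 -> (x \in rootsR p) = root p x.
Proof. by move=> p0; rewrite -(roots_on_rootsR p0) in_itv. Qed.

(** Double counting: after exchanging the sums, each entry of [s] is counted at exactly one root. *)
Lemma real_root_countE (R : rcfType) (g : {poly R}) s :
  (forall x, ~~ root g x) ->
  real_root_count (g * \prod_(y <- s) ('X - y%:P)) = size s.
Proof.
move=> gN; set p := g * _.
have g0 : g != 0 by apply: contraNneq (gN 0) => ->; rewrite root0.
have p0 : p != 0 by rewrite mulf_neq0 // monic_neq0 ?monic_prod_XsubC.
rewrite /real_root_count (eq_bigr (fun x => count_mem x s)) => [|x _]; last exact: mup_prod_XsubC.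
under eq_bigr do rewrite -sum1_count.
under eq_bigr do rewrite big_mkcond /=.
rewrite exchange_big /= -sum1_size big_seq [RHS]big_seq; apply: eq_bigr => y ys.
rewrite (bigD1_seq y) ?uniq_roots //= ?eqxx ?big1 // => [x|].
  by rewrite eq_sym => /negPf ->.
by rewrite mem_rootsR // rootM orbC root_prod_XsubC ys.
Qed.

Lemma factor_real_roots (R : rcfType) (p : {poly R}) : p != 0 ->
  exists g s, p = g * \prod_(y <- s) ('X - y%:P) /\ forall x, ~~ root g x.
Proof.
elim: {p}(size p) {-2}p (leqnn (size p)) => [|n IHn] p.
  by rewrite leqn0 size_poly_eq0 => ->.
move=> szp p0; have [[x /factor_theorem[q pE]]|noroot] := pselect (exists x, root p x).
  have q0 : q != 0 by apply: contraNneq p0 => q0; rewrite pE q0 mul0r.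
  have [|g [s [qE gN]]] := IHn q _ q0.
    by move: szp; rewrite pE size_Mmonic ?monicXsubC // size_XsubC addn2.
  by exists g, (x :: s); rewrite big_cons mulrCA mulrC -qE.
exists p, [::]; rewrite big_nil mulr1; split=> // x.
by apply/negP => rx; apply: noroot; exists x.
Qed.

Lemma leq_real_root_count (R : rcfType) (p : {poly R}) s :
  p != 0 -> \prod_(y <- s) ('X - y%:P) %| p -> (size s <= real_root_count p)%N.
Proof.
move=> p0 /dvdpP[q pE].
have q0 : q != 0 by apply: contraNneq p0 => q0; rewrite pE q0 mul0r.
have [g [s' [qE gN]]] := factor_real_roots q0.
by rewrite pE qE -mulrA -big_cat real_root_countE // size_cat leq_addl.
Qed.

Lemma real_root_count_dvd (R : rcfType) (p : {poly R}) : p != 0 ->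
  exists2 s, size s = real_root_count p & \prod_(y <- s) ('X - y%:P) %| p.
Proof.
move=> /factor_real_roots[g [s [-> gN]]].
by exists s; rewrite ?real_root_countE // dvdp_mull.
Qed.

Lemma real_root_count_mulXn (R : rcfType) n (p : {poly R}) : p != 0 ->
  real_root_count ('X^n * p) = (n + real_root_count p)%N.
Proof.
move=> /factor_real_roots[g [s [-> gN]]].
have -> : 'X^n = \prod_(y <- nseq n (0 : R)) ('X - y%:P).
  by rewrite big_nseq subr0 -Monoid.iteropE.
by rewrite mulrCA -big_cat !real_root_countE // size_cat size_nseq.
Qed.

(** * Closedness of root conditions and variation of the root count *)

Section RootContinuity.
Local Open Scope classical_set_scope.

(** Tube lemma: if the fibre over [x] misses [W] along the compact [K], so do all nearby fibres. *)
Lemma closed_compact_proj (X Y : topologicalType) (K : set Y) (W : set (X * Y)) :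
  compact K -> closed W -> closed [set x | exists2 y, K y & W (x, y)].
Proof.
move=> /compact_near_coveringP cK cW; rewrite -openC openE => x /= xN.
have : \forall x' \near x, K `<=` (fun y => ~ W (x', y)).
  apply: cK => y Ky.
  have : nbhs (x, y) (~` W).
    by apply: open_nbhs_nbhs; split; [rewrite openC | move=> Wxy; apply: xN; exists y].
  move=> [[U V] /= [xU yV] UVW].
  by exists (V, U) => // -[y' x'] /= [Vy' Ux']; apply: (UVW (x', y')).
by apply: filterS => x' KW [y Ky]; apply: KW.
Qed.

(** Horner's scheme: the quotient's coefficients are the Horner tails of [p] at [r]. This explicit
    form is polynomial in [r] and the coefficients of [p], hence continuous, and is defined even
    when [r] is not a root. *)
Lemma synthetic_division (R : comNzRingType) (p : {poly R}) d r : (size p <= d)%N ->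
  p = (\poly_(i < d) (drop_poly i.+1 p).[r]) * ('X - r%:P) + p.[r]%:P.
Proof.
move=> szp; set q := \poly_(i < d) _.
have qE i : q`_i = (drop_poly i.+1 p).[r].
  rewrite coef_poly; case: ltnP => // di.
  by rewrite drop_poly_eq0 ?horner0 // (leq_trans szp) // ltnW.
have drop_step i : (drop_poly i p).[r] = p`_i + (drop_poly i.+1 p).[r] * r.
  have -> : drop_poly i p = (p`_i)%:P + drop_poly i.+1 p * 'X.
    apply/polyP => -[|j]; rewrite coefD coefC coefMX !coef_drop_poly /= ?addr0 //.
    by rewrite add0r addSnnS.
  by rewrite hornerD hornerC hornerMX.
apply/polyP => i; rewrite coefD coefC mulrBr coefB coefMX coefMC !qE.
case: i => [|i] /=; last by rewrite addr0 (drop_step i.+1) addrK.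
have -> : p.[r] = (drop_poly 0 p).[r] by rewrite drop_poly0l.
by rewrite (drop_step 0) sub0r addrC addrK.
Qed.

Lemma dvdp_cons_XsubC (F : fieldType) (p : {poly F}) d r s : (size p <= d)%N ->
  (\prod_(x <- r :: s) ('X - x%:P) %| p) =
  root p r && (\prod_(x <- s) ('X - x%:P) %| \poly_(i < d) (drop_poly i.+1 p).[r]).
Proof.
move=> szp; rewrite big_cons; set P := \prod_(x <- s) _; set q := \poly_(i < d) _.
have pE := synthetic_division r szp; rewrite -/q in pE.
have X0 : 'X - r%:P != 0 by rewrite polyXsubC_eq0.
case: (boolP (root p r)) => [/rootP pr0|prN] /=.
  by rewrite pE pr0 addr0 [q * _]mulrC dvdp_mul2l.
apply: contraNF prN; rewrite root_factor_theorem.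
by apply: dvdp_trans; apply: dvdp_mulIl.
Qed.

Lemma continuous_sum (R : realType) (Z : topologicalType) n (f : 'I_n -> Z -> R) :
  (forall i, continuous (f i)) -> continuous (fun z => \sum_(i < n) f i z).
Proof.
elim: n f => [|n IHn] f cf z.
  have -> : (fun z => \sum_(i < 0) f i z) = cst 0 by apply/funext => y; rewrite big_ord0.
  exact: cst_continuous.
have -> : (fun z => \sum_(i < n.+1) f i z) = (fun z => f ord0 z + \sum_(i < n) f (lift ord0 i) z).
  by apply/funext => y; rewrite big_ord_recl.
by apply: cvgD; [exact: cf | apply: IHn => i; exact: cf].
Qed.

(** Induction on [k]: choosing one root [r] in [K] exhibits the set as the projection along [K] of a
    closed set of pairs [(z, r)], where the quotient by ['X - r] must have [k - 1] further roots in
    [K]. The uniform bound [d] makes evaluation a sum of fixed length. *)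
Lemma closed_dvdp_roots (R : realType) (K : set R) k d (Z : topologicalType)
    (p : Z -> {poly R}) :
  compact K -> (forall z, (size (p z) <= d)%N) -> (forall i, continuous (fun z => (p z)`_i)) ->
  closed [set z | exists s, [/\ size s = k, forall x, x \in s -> K x
                              & \prod_(x <- s) ('X - x%:P) %| p z]].
Proof.
move=> cK; elim: k Z p => [|k IHk] Z p szp cp.
  rewrite [X in closed X](_ : _ = setT); first exact: closedT.
  by apply/seteqP; split=> // z _; exists [::]; rewrite big_nil dvd1p.
have c_drop i : continuous (fun zr : Z * R => (drop_poly i (p zr.1)).[zr.2]).
  have -> : (fun zr : Z * R => (drop_poly i (p zr.1)).[zr.2]) =
            (fun zr => \sum_(j < d) (p zr.1)`_(j + i) * zr.2 ^+ j).
    apply/funext => -[z r] /=; rewrite (@horner_coef_wide _ d).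
      by apply: eq_bigr => j _; rewrite coef_drop_poly.
    by rewrite size_drop_poly (leq_trans (leq_subr _ _)).
  apply: continuous_sum => j zr; apply: cvgM.
    by apply: (@continuous_comp _ _ _ fst (fun z => (p z)`_(j + i))); [exact: cvg_fst | exact: cp].
  have cX := @exprn_continuous R j zr.2.
  apply: (@continuous_comp (Z * R)%type R R snd (fun r : R => r ^+ j) zr).
    exact: cvg_snd.
  exact: cX.
pose q (zr : Z * R) := \poly_(i < d) (drop_poly i.+1 (p zr.1)).[zr.2].
have szq zr : (size (q zr) <= d)%N by apply: size_poly.
have cq i : continuous (fun zr => (q zr)`_i).
  have [lt|ge] := ltnP i d.
    have -> : (fun zr => (q zr)`_i) = (fun zr => (drop_poly i.+1 (p zr.1)).[zr.2]).
      by apply/funext => zr; rewrite coef_poly lt.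
    exact: c_drop.
  have -> : (fun zr => (q zr)`_i) = cst 0.
    by apply/funext => zr; rewrite coef_poly ltnNge ge.
  exact: cst_continuous.
have cR : closed [set zr : Z * R | (p zr.1).[zr.2] = 0].
  have -> : [set zr : Z * R | (p zr.1).[zr.2] = 0] =
      (fun zr => (drop_poly 0 (p zr.1)).[zr.2]) @^-1` [set 0].
    by apply/seteqP; split => zr /=; rewrite drop_poly0l.
  by have /continuous_closedP := c_drop 0; apply; exact: closed_eq.
have := closed_compact_proj cK (closedI cR (IHk _ q szq cq)).
congr closed; apply/seteqP; split => z /=.
  move=> [r Kr [/= pr0 [s [szs sK sq]]]]; exists (r :: s); split; first by rewrite /= szs.
    by move=> x; rewrite inE => /predU1P[->|/sK].
  by rewrite (dvdp_cons_XsubC _ _ (szp z)) sq andbT; apply/rootP.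
move=> [[|r s] [// [szs] sK]]; rewrite (dvdp_cons_XsubC _ _ (szp z)) => /andP[/rootP pr0 sq].
exists r; first by apply: sK; rewrite mem_head.
by split => //; exists s; split => // x xs; apply: sK; rewrite inE xs orbT.
Qed.

Lemma nonzero_near0 (R : realType) (p : {poly R}) : p.[0] != 0 ->
  exists2 e : R, 0 < e & forall x, `|x| <= e -> p.[x] != 0.
Proof.
move=> p0; have /cvgrPdist_lt /(_ `|p.[0]|) := @continuous_horner R p 0.
rewrite normr_gt0 => /(_ p0) /nbhs_ballP[e /= e0 He].
exists (e / 2) => [|x xe]; first by rewrite divr_gt0.
have /He /= : ball (0 : R) e x by rewrite /ball /= sub0r normrN; lra.
by apply: contraTneq => ->; rewrite subr0 ltxx.
Qed.

Lemma monic_family (R : realType) (psi q : {poly R}) (e c : R) :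
  psi \is monic -> (size q <= (size psi).+1)%N ->
  ('X^2 - c%:P) * psi - e *: q \is monic /\
  size (('X^2 - c%:P) * psi - e *: q) = (size psi).+2.
Proof.
move=> psi_m szq.
have m2 : 'X^2 - c%:P \is monic by rewrite monicXnsubC.
have sz2 : size (('X^2 - c%:P) * psi) = (size psi).+2.
  by rewrite size_monicM ?monic_neq0 // size_XnsubC.
have lt : (size (- (e *: q))%R < size (('X^2 - c%:P) * psi)%R)%N.
  by rewrite sz2 size_polyN (leq_ltn_trans (size_scale_leq _ _)).
split; last by rewrite size_polyDl.
by rewrite monicE lead_coefDl // -monicE monicMl.
Qed.

(* With [h x = x^2 - e q(x)/psi(x)], the real roots of the [c]-th polynomial near
   [0] solve [h x = c]; for small [e] this [h] has an interior minimum [m] on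
   [[-d, d]].  For [c < m] all [k] real roots stay outside [(-d, d)], so by
   closedness the same holds at [c = m], where the minimizer is an extra root. *)
Lemma real_root_count_not_constant (R : realType) (psi q : {poly R}) k :
  psi \is monic -> psi.[0] != 0 -> (size q <= (size psi).+1)%N ->
  ~ forall e c : R, 0 < e ->
      real_root_count (('X^2 - c%:P) * psi - e *: q) = k.
Proof.
move=> psi_m psi0 szq cnt.
have [d d0 psid] := nonzero_near0 psi0.
pose f x := q.[x] / psi.[x].
(* Small enough that [e * (f x - f 0) < d ^+ 2] at both endpoints, which makes [h 0] lie below [h d]
   and [h (- d)]. *)
pose e := d ^+ 2 / (1 + `|f 0 - f d| + `|f 0 - f (- d)|).
have D0 : 0 < 1 + `|f 0 - f d| + `|f 0 - f (- d)|.
  by rewrite -addrA ltr_pwDl // addr_ge0.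
have e0 : 0 < e by rewrite divr_gt0 // exprn_gt0.
have eD : e * (1 + `|f 0 - f d| + `|f 0 - f (- d)|) = d ^+ 2.
  by rewrite /e mulfVK // gt_eqF.
pose h x := x ^+ 2 - e * f x.
have hd x : x = d \/ x = - d -> h 0 < h x.
  move=> xd; rewrite /h expr0n /= sub0r.
  suff : e * (f x - f 0) < x ^+ 2 by rewrite mulrBr; lra.
  have -> : x ^+ 2 = d ^+ 2 by case: xd => ->; rewrite ?sqrrN.
  rewrite -eD ltr_pM2l //; have := normr_ge0 (f 0 - f d); have := normr_ge0 (f 0 - f (- d)).
  have n1 := ler_norm (- (f 0 - f d)); have n2 := ler_norm (- (f 0 - f (- d))).
  by rewrite !normrN in n1 n2; case: xd => -> ; lra.
have memd x : x \in `[- d, d]%R -> `|x| <= d by rewrite in_itv /= ler_norml.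
have ch : {within `[- d, d], continuous h}.
  apply: continuous_in_subspaceT => x; rewrite inE /= => xd.
  have px : psi.[x] != 0 by apply/psid/memd.
  apply: cvgB; first exact: exprn_continuous.
  apply: cvgMl_tmp; apply: cvgM; first exact: continuous_horner.
  by apply: cvgV => //; exact: continuous_horner.
have dd : - d <= d by lra.
have [m /[dup] mI /memd md hmin] := EVT_min dd ch.
have {}md : `|m| < d.
  have h0 : h m <= h 0 by apply: hmin; rewrite in_itv /=; lra.
  rewrite lt_neqAle md andbT; apply: contraTneq h0 => mE; rewrite -ltNge.
  apply: hd; have [m0|m0] := ger0P m; [left|right]; rewrite -mE.
    by rewrite ger0_norm.
  by rewrite ltr0_norm // opprK.
pose G c := ('X^2 - c%:P) * psi - e *: q.
have G_m c : G c \is monic by have [] := @monic_family _ psi q e c psi_m szq.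
have G_sz c : size (G c) = (size psi).+2 by have [] := @monic_family _ psi q e c psi_m szq.
have G0 c : G c != 0 by rewrite monic_neq0.
have rootG c x : psi.[x] != 0 -> root (G c) x = (h x == c).
  move=> px; have -> : root (G c) x = ((h x - c) * psi.[x] == 0).
    rewrite /root /G /h /f hornerD hornerN hornerZ hornerM hornerD hornerN hornerC hornerXn.
    by congr (_ == 0); field.
  by rewrite mulf_eq0 (negPf px) orbF subr_eq0.
have coefG c i : (G c)`_i = ('X^2 * psi - e *: q)`_i - c * psi`_i.
  by rewrite /G mulrBl !coefB coefCM; ring.
(* Cauchy's root bound, made uniform over [|c| <= |h m| + 1]. *)
pose M := 1 + \sum_(i < (size psi).+2) (`|('X^2 * psi - e *: q)`_i| + (`|h m| + 1) * `|psi`_i|).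
have boundM c x : `|c| <= `|h m| + 1 -> root (G c) x -> `|x| <= M.
  move=> cM /rootP rx; apply: le_trans (ltW (cauchy_boundP (G0 c) rx)) _.
  rewrite /cauchy_bound (monicP (G_m c)) normr1 invr1 mul1r G_sz lerD2l.
  apply: ler_sum => i _; rewrite coefG; apply: le_trans (ler_normB _ _) _.
  by rewrite lerD2l normrM ler_wpM2r.
pose K : set R := `[- M, - d] `|` `[d, M].
have cK : compact K by apply: compactU; exact: segment_compact.
have cG i : continuous (fun c => (G c)`_i).
  have -> : (fun c => (G c)`_i) = (fun c => ('X^2 * psi - e *: q)`_i - c * psi`_i).
    by apply/funext => c; exact: coefG.
  by move=> c; apply: cvgB; [exact: cvg_cst | apply: cvgMr_tmp; exact: cvg_id].
have szG c : (size (G c) <= (size psi).+2)%N by rewrite G_sz.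
have := @closed_dvdp_roots R K k _ _ G cK szG cG.
set S := [set c | _] => cS.
have S_below c : h m - 1 < c -> c < h m -> S c.
  move=> c1 c2; have [s szs sG] := real_root_count_dvd (G0 c).
  exists s; split => //; first by rewrite szs cnt.
  move=> x xs; have rx : root (G c) x.
    rewrite root_factor_theorem; apply: dvdp_trans sG.
    by rewrite -root_factor_theorem root_prod_XsubC.
  have xM : `|x| <= M.
    apply: boundM rx; have := ler_norm (h m); have := ler_norm (- h m).
    by rewrite normrN ler_norml; lra.
  have xd : d <= `|x|.
    rewrite leNgt; apply/negP => xd.
    have := hmin x; rewrite in_itv /= -ler_norml (ltW xd) => /(_ isT).
    by move: rx; rewrite rootG ?psid ?(ltW xd) // => /eqP ->; rewrite leNgt c2.
  have /andP[xM1 xM2] : - M <= x <= M by rewrite -ler_norml.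
  by move: xd; case: (ger0P x) => x0 xd; [right|left]; rewrite /= in_itv /=; lra.
(* [S] is closed and contains every [c] just below [h m]; the minimum with 1 keeps [c] above
   [h m - 1]. *)
have [s [szs sK sG]] : S (h m).
  have -> : S = closure S by apply/closure_id.
  move=> B /nbhs_ballP[r /= r0 rB]; pose c := h m - Num.min r 1 / 2.
  have mr : Num.min r 1 <= r by rewrite ge_min lexx.
  have m1 : Num.min r 1 <= 1 by rewrite ge_min lexx orbT.
  have m0 : 0 < Num.min r 1 by rewrite lt_min r0 ltr01.
  exists c; split; first by apply: S_below; rewrite /c; lra.
  by apply: rB; rewrite /ball /= /c opprB addrCA subrr addr0 ger0_norm; lra.
have rm : root (G (h m)) m by rewrite rootG ?eqxx // psid // ltW.
(* All of [s] lies in [K], outside [(-d, d)], so [m] is a root beyond the [k] already found. *)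
have : \prod_(x <- m :: s) ('X - x%:P) %| G (h m).
  rewrite big_cons Gauss_dvdp ?sG ?andbT; first by rewrite -root_factor_theorem.
  rewrite coprimep_sym coprimep_XsubC root_prod_XsubC; apply/negP => /sK.
  by move: md; rewrite ltr_norml /K => /andP[m1 m2] [] /=; rewrite in_itv /=; lra.
by move=> /(leq_real_root_count (G0 _)); rewrite cnt //= szs ltnn.
Qed.

End RootContinuity.

(** * Two leaves at a common vertex *)

Lemma row'_col_mx0 (R : Type) m n (u : 'rV[R]_n) (A : 'M_(m, n)) :
  row' 0 (col_mx u A) = A.
Proof.
apply/matrixP => i j; rewrite mxE.
have -> : lift 0 i = rshift 1 i by apply/val_inj.
exact: (@col_mxEd _ 1 m n u A i j).
Qed.

Lemma row0_col_mx (R : Type) m n (u : 'rV[R]_n) (A : 'M_(m, n)) : row 0 (col_mx u A) = u.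
Proof.
apply/rowP => j; rewrite mxE.
have -> : 0 = lshift m (0 : 'I_1) by apply/val_inj.
exact: col_mxEu.
Qed.

Lemma det_col_mx_linear (R : comNzRingType) m (u v : 'rV[R]_(1 + m)) (A : 'M_(m, 1 + m)) b c :
  \det (col_mx (b *: u + c *: v) A : 'M_(1 + m)) =
    b * \det (col_mx u A : 'M_(1 + m)) + c * \det (col_mx v A : 'M_(1 + m)).
Proof.
by apply: (@determinant_multilinear R (1 + m) _ _ _ 0); rewrite ?row0_col_mx ?row'_col_mx0.
Qed.

Lemma det_block_addul (R : comNzRingType) m (s t : R) (a : 'rV_m) (b : 'cV_m) (D : 'M_m) :
  \det (block_mx (s + t)%:M a b D) = \det (block_mx s%:M a b D) + t * \det D.
Proof.
have -> : t * \det D = \det (block_mx t%:M 0 b D) by rewrite det_lblock det_scalar1.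
have := @det_col_mx_linear R m (row_mx s%:M a) (row_mx t%:M 0) (row_mx b D) 1 1.
rewrite !mul1r !scale1r /block_mx => <-.
by rewrite add_row_mx addr0 -raddfD.
Qed.

Lemma char_poly_mx_block (R : nzRingType) m n (A : 'M[R]_m) B C (D : 'M[R]_n) :
  char_poly_mx (block_mx A B C D) =
  block_mx (char_poly_mx A) (- map_mx polyC B) (- map_mx polyC C) (char_poly_mx D).
Proof.
by rewrite /char_poly_mx map_block_mx scalar_mx_block opp_block_mx add_block_mx !sub0r.
Qed.

(** The determinant is linear in the first row, and the row with [e *: a] is the combination, with
    weights [1 - e] and [e], of the rows with [0] and [a]. *)
Lemma char_poly_block_scale (R : comNzRingType) m (a : 'rV[R]_m) (b : 'cV_m) C e :
  char_poly (block_mx (0 : 'M_1) (e *: a) b C) =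
  (1 - e)%:P * ('X * char_poly C) + e%:P * char_poly (block_mx (0 : 'M_1) a b C).
Proof.
have -> : 'X * char_poly C = char_poly (block_mx (0 : 'M_1) 0 b C).
  rewrite /char_poly char_poly_mx_block map_mx0 oppr0 det_lblock; congr (_ * _).
  by rewrite /char_poly_mx map_mx0 subr0 det_scalar1.
rewrite /char_poly !char_poly_mx_block /block_mx -det_col_mx_linear.
congr (\det (col_mx _ _)).
rewrite !scale_row_mx add_row_mx -scalerDl -polyCD subrK scale1r.
rewrite map_mx0 oppr0 scaler0 add0r scalerN; congr (row_mx _ (- _)).
by apply/rowP => j; rewrite !mxE polyCM.
Qed.

(* Clearing the leaf columns by the leaf rows leaves [c] in the corner of ['X - B]. *)
Lemma char_poly_leaves (R : idomainType) k m (x : 'cV[R]_k) (y : 'rV[R]_k)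
    (a : 'rV[R]_m) (b : 'cV_m) C (B := block_mx (0 : 'M_1) a b C) :
  'X * char_poly (block_mx 0 (x *m row_mx 1%:M 0) (col_mx 1%:M 0 *m y) B) =
  'X^k * ('X * char_poly B - ((y *m x) 0 0)%:P * char_poly C).
Proof.
set c := (y *m x) 0 0; pose A := block_mx (0 : 'M_k) (x *m row_mx 1%:M 0) (col_mx 1%:M 0 *m y) B.
pose U := map_mx polyC (x *m row_mx 1%:M (0 : 'M_(1, m))).
pose L := map_mx polyC (col_mx 1%:M (0 : 'M_(m, 1)) *m y).
have LU : L *m U = block_mx (c%:P)%:M 0 0 0.
  rewrite /L /U -map_mxM mulmxA -(mulmxA _ y) [y *m x]mx11_scalar -/c.
  rewrite mul_mx_scalar -scalemxAl mul_col_row mul1mx mulmx0 !mul0mx scale_block_mx.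
  by rewrite map_block_mx !scaler0 !map_mx0 scalemx1 map_scalar_mx.
have : char_poly_mx A *m block_mx 1%:M U 0 'X%:M =
  block_mx 'X%:M 0 (- L) ('X *: char_poly_mx B - L *m U).
  rewrite char_poly_mx_block -/U -/L mulmx_block !mulmx1 !mulmx0 !addr0.
  rewrite /char_poly_mx map_mx0 subr0 mul_scalar_mx mulNmx mul_mx_scalar subrr.
  by rewrite mulNmx mul_mx_scalar addrC.
move=> /(congr1 determinant); rewrite det_mulmx det_ublock det_lblock det1 mul1r !det_scalar.
(* [L *m U] is [c] in the corner, so linearity in the first row separates off [c] times the
   determinant of ['X *: char_poly_mx C]. *)
have -> : 'X *: char_poly_mx B - L *m U =
    block_mx ('X * 'X - c%:P)%:M ('X *: - map_mx polyC a)
             ('X *: - map_mx polyC b) ('X *: char_poly_mx C).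
  rewrite LU char_poly_mx_block scale_block_mx opp_block_mx add_block_mx !oppr0 !addr0.
  by rewrite /char_poly_mx map_mx0 subr0 scale_scalar_mx -raddfB.
rewrite det_block_addul -scale_scalar_mx -scale_block_mx.
have -> : block_mx 'X%:M (- map_mx polyC a) (- map_mx polyC b) (char_poly_mx C) = char_poly_mx B.
  by rewrite char_poly_mx_block [char_poly_mx 0]/char_poly_mx map_mx0 subr0.
rewrite !detZ -!/(char_poly _) mulNr => E.
have Xm : 'X^m != 0 :> {poly R} by rewrite monic_neq0 ?monicXn.
apply: (mulfI Xm); rewrite mulrA -exprSr mulrC E.
by rewrite exprS; ring.
Qed.

(** The border is a sum of two matrices of rank at most one. *)
Lemma rank_block_border (F : fieldType) m (d : 'M[F]_1) (a : 'rV_m) b (C : 'M_m) :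
  (\rank (block_mx d a b C) <= \rank C + 2)%N.
Proof.
have -> : block_mx d a b C = col_mx 0 1%:M *m C *m row_mx 0 1%:M
    + (col_mx 1%:M 0 *m row_mx d a + col_mx 0 b *m row_mx 1%:M 0).
  rewrite mul_col_mx mul0mx mul1mx !mul_col_row !mulmx0 !mul0mx !mulmx1 !mul1mx.
  by rewrite !add_block_mx !addr0 !add0r.
apply: leq_trans (mxrank_add _ _) _; apply: leq_add.
  by apply: leq_trans (mxrankM_maxl _ _) _; apply: mxrankM_maxr.
apply: leq_trans (mxrank_add _ _) _; apply: (@leq_add _ _ 1 1).
  by apply: leq_trans (mxrankM_maxr _ _) _; apply: rank_leq_row.
by apply: leq_trans (mxrankM_maxr _ _) _; apply: rank_leq_row.
Qed.

Lemma size_sub_monic (R : nzRingType) (p q : {poly R}) n :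
  p \is monic -> q \is monic -> size p = n.+1 -> size q = n.+1 -> (size (p - q)%R <= n)%N.
Proof.
rewrite !monicE !lead_coefE => pm qm sp sq; move: pm qm; rewrite sp sq /= => /eqP pn /eqP qn.
apply/leq_sizeP => j; rewrite leq_eqVlt coefB => /predU1P[<-|nj].
  by rewrite pn qn subrr.
by rewrite !nth_default ?subrr // ?sp ?sq.
Qed.

(** Write [j = m - \rank C], [char_poly C = 'X^j * psi] and ['X * char_poly B = 'X^j * q1]; the
    identities for the leaves and for the scaled row then give the family with
    [q = 'X^2 * psi - q1]. *)
Lemma char_poly_leaves_family (F : fieldType) k m (a : 'rV[F]_m) b (C : 'M_m) :
  (char_poly C)`_(m - \rank C) != 0 ->
  exists psi q : {poly F}, [/\ psi \is monic, psi.[0] != 0, (size q <= (size psi).+1)%N &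
    forall e (x : 'cV_k.+1) y,
      char_poly (block_mx 0 (x *m row_mx 1%:M 0) (col_mx 1%:M 0 *m y)
                   (block_mx (0 : 'M_1) (e *: a) b C)) =
      'X^(k + (m - \rank C)) * (('X^2 - ((y *m x) 0 0)%:P) * psi - e *: q)].
Proof.
set j := (m - \rank C)%N => Cj.
have Xn_neq0 i : 'X^i != 0 :> {poly F} by rewrite monic_neq0 ?monicXn.
have /dvdpP[psi psiE] := dvdp_Xn_char_poly C; rewrite -/j in psiE.
pose B := block_mx (0 : 'M_1) a b C.
(* [B] has order [m + 1] and rank at most [\rank C + 2], so ['X^(j - 1)] divides [char_poly B]; the
   extra ['X] makes up the difference. *)
have /dvdpP[q1 q1E] : 'X^j %| 'X * char_poly B.
  apply: dvdp_trans (dvdp_mul (dvdpp 'X) (dvdp_Xn_char_poly B)).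
  rewrite -exprS dvdp_exp2l //; have := rank_block_border 0 a b C; rewrite -/B /j.
  by have := rank_leq_row C; lia.
have psi_m : psi \is monic.
  by rewrite -(monicMr _ (monicXn _ j)) -psiE char_poly_monic.
have szpsi : (size psi + j)%N = m.+1.
  by have := size_char_poly C; rewrite psiE size_Mmonic ?monic_neq0 ?monicXn // size_polyXn addnS.
have qE : ('X^2 * psi - q1) * 'X^j = 'X * ('X * char_poly C - char_poly B).
  by rewrite mulrBl -mulrA -psiE -q1E; ring.
exists psi, ('X^2 * psi - q1); split => //.
- by move: Cj; rewrite psiE coefMXn ltnn subnn horner_coef0.
- have [->|q0] := eqVneq ('X^2 * psi - q1) 0; first by rewrite size_poly0.
  (* ['X * char_poly C] and [char_poly B] are monic of the same degree, so their leading terms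
     cancel. *)
  have : (size (('X^2 * psi - q1) * 'X^j)%R <= m.+2)%N.
    rewrite qE; apply: leq_trans (size_polyMleq _ _) _; rewrite size_polyX /=.
    apply: size_sub_monic; rewrite ?monicMl ?monicX ?char_poly_monic ?size_char_poly //.
    by rewrite mulrC size_mulX ?monic_neq0 ?char_poly_monic // size_char_poly.
  by rewrite size_Mmonic ?monicXn // size_polyXn; lia.
move=> e x y; set c := (y *m x) 0 0; apply: (mulfI (Xn_neq0 1%N)).
rewrite expr1 char_poly_leaves char_poly_block_scale -/B -/c.
rewrite [RHS]mulrA -exprS -addSn exprD -[RHS]mulrA; congr (_ * _).
have -> : 'X * ((1 - e)%:P * ('X * char_poly C) + e%:P * char_poly B) - c%:P * char_poly C
  = (1 - e%:P) * 'X^2 * char_poly C + e%:P * ('X * char_poly B) - c%:P * char_poly C.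
  by rewrite polyCB; ring.
by rewrite psiE q1E -mul_polyC; ring.
Qed.

(** * Relabelling the vertices and the contradiction *)

Lemma char_poly_row_col_perm (R : idomainType) n (s : 'S_n) (A : 'M[R]_n) :
  char_poly (row_perm s (col_perm s A)) = char_poly A.
Proof.
have Xn : 'X^n != 0 :> {poly R} by rewrite monic_neq0 ?monicXn.
rewrite row_permE col_permE; apply: (mulfI Xn).
by rewrite char_poly_mulmxC -mulmxA -perm_mxM mulVg perm_mx1 mulmx1.
Qed.

Lemma consistent_row_col_perm (R : realType) n (s : 'S_n) (P : sign_pattern n) :
  consistent R P -> consistent R (row_perm s (col_perm s P)).
Proof.
move=> [k Pk]; exists k => A PA.
rewrite -(Pk (row_perm s^-1 (col_perm s^-1 A))).
  by rewrite /real_eigenvalue_count char_poly_row_col_perm.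
apply/matrixP => i j; move/matrixP/(_ ((s^-1)%g i) ((s^-1)%g j)): PA.
by rewrite !mxE !permKV.
Qed.

Lemma exists_perm3 (T : finType) (a b c u v w : T) :
  a != b -> a != c -> b != c -> u != v -> u != w -> v != w ->
  exists s : {perm T}, [/\ s a = u, s b = v & s c = w].
Proof.
move=> ab ac bc uv uw vw.
pose s1 := tperm a u; pose s2 := (s1 * tperm (s1 b) v)%g; pose s3 := (s2 * tperm (s2 c) w)%g.
have s1a : s1 a = u by rewrite tpermL.
have s2a : s2 a = u.
  by rewrite permM s1a tpermD // ?(eq_sym v) // -s1a (inj_eq perm_inj) eq_sym.
have s2b : s2 b = v by rewrite permM tpermL.
exists s3; split; last by rewrite permM tpermL.
  by rewrite permM s2a tpermD // ?(eq_sym w) // -s2a (inj_eq perm_inj) eq_sym.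
by rewrite permM s2b tpermD // ?(eq_sym w) // -s2b (inj_eq perm_inj) eq_sym.
Qed.

Lemma sgn_val_mul (R : pzRingType) s t :
  sgn_val R (sign_mul s t) = sgn_val R s * sgn_val R t.
Proof. by case: s t => -[] /=; rewrite ?mulr0 ?mul0r ?mulrNN ?mulr1 ?mul1r. Qed.

(** With the leaves and [w] at the first three indices, a member of the class has the block form of
    [char_poly_leaves_family], where [e > 0] and [c] can be prescribed freely. *)
Lemma inconsistent_opposite_leaves (R : realType) m (P : sign_pattern (2 + (1 + m)))
    (u := lshift (1 + m) (0 : 'I_2)) (v := lshift (1 + m) (1 : 'I_2)) (w := rshift 2 (lshift m 0)) :
  combinatorially_symmetric P -> zero_diagonal P ->
  (forall (i : 'I_2) j, j != w -> P (lshift (1 + m) i) j = Zero) ->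
  edge_sign P u w = Plus -> edge_sign P v w = Minus -> ~ consistent R P.
Proof.
move=> Psym P0 Pleaf Pu Pv [k Pk].
have PleafT (i : 'I_2) j : j != w -> P j (lshift (1 + m) i) = Zero.
  move=> /(Pleaf i) Pij; apply/eqP/negP => /negP/eqP.
  by move=> /Psym; rewrite Pij.
pose r (j : 'I_m) := rshift 2 (rshift 1 j).
have rw j : r j != w by [].
pose PC : sign_pattern m := \matrix_(i, j) P (r i) (r j).
have PCsym : combinatorially_symmetric PC by move=> i j; rewrite !mxE; exact: Psym.
have [C PC_C semiC] := exists_semisimple_zero R PCsym.
pose a : 'rV[R]_m := \row_j sgn_val R (P w (r j)).
pose b : 'cV[R]_m := \col_j sgn_val R (P (r j) w).
have [psi [q [psi_m psi0 szq famE]]] := char_poly_leaves_family 1 a b semiC.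
(* The power of ['X] in front of the family accounts for [1 + (m - \rank C)] zero eigenvalues. *)
apply: (@real_root_count_not_constant R psi q (k - (1 + (m - \rank C))) psi_m psi0 szq).
move=> e c e0.
(* Two positive weights whose difference is [c]: the positive edge contributes the first, the
   negative edge minus the second. *)
pose al (i : 'I_2) : R := if i == 0 then c + `|c| + 1 else `|c| + 1.
have al0 i : 0 < al i.
  by rewrite /al; have := ler_norm (- c); rewrite normrN; have := normr_ge0 c; case: ifP => _; lra.
pose x : 'cV[R]_2 := \col_i sgn_val R (P (lshift (1 + m) i) w).
pose y : 'rV[R]_2 := \row_i (al i * sgn_val R (P w (lshift (1 + m) i))).
have yx : (y *m x) 0 0 = c.
  rewrite mxE big_ord_recl big_ord1 !mxE -!mulrA.
  rewrite ![sgn_val R (P w _) * _]mulrC -!sgn_val_mul.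
  have -> : lift ord0 ord0 = 1 :> 'I_2 by apply/val_inj.
  have -> : sign_mul (P (lshift (1 + m) ord0) w) (P w (lshift (1 + m) ord0)) = Plus by exact: Pu.
  have -> : sign_mul (P v w) (P w v) = Minus by exact: Pv.
  by rewrite /al /=; ring.
have := famE e x y; rewrite yx; set A := block_mx 0 _ _ _ => AE.
set G := _ - e *: q in AE *.
have G0 : G != 0 by rewrite monic_neq0 //; have [] := monic_family e c psi_m szq.
rewrite -(Pk A) /real_eigenvalue_count; last first.
  apply/matrixP => i j; rewrite mxE /A mul_mx_row mul_col_mx mulmx1 mul1mx mulmx0 mul0mx.
  have [i1 ->|i1 ->] := split_ordP i; have [j1 ->|j1 ->] := split_ordP j.
  - by rewrite block_mxEul mxE sign_of0 Pleaf // eq_lrshift.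
  - rewrite block_mxEur; have [j2 ->|j2 ->] := split_ordP j1.
      rewrite row_mxEl mxE [j2]ord1 -[sgn_val _ _]mul1r.
      by rewrite sign_of_mul_sgn_val ?ltr01.
    by rewrite row_mxEr mxE sign_of0 Pleaf.
  - rewrite block_mxEdl; have [i2 ->|i2 ->] := split_ordP i1.
      by rewrite col_mxEu mxE [i2]ord1 sign_of_mul_sgn_val.
    by rewrite col_mxEd mxE sign_of0 PleafT.
  rewrite block_mxEdr; have [i2 ->|i2 ->] := split_ordP i1; have [j2 ->|j2 ->] := split_ordP j1.
  - by rewrite block_mxEul mxE sign_of0 [i2]ord1 [j2]ord1 P0.
  - by rewrite block_mxEur !mxE [i2]ord1 sign_of_mul_sgn_val.
  - rewrite block_mxEdl !mxE [j2]ord1 -[sgn_val _ _]mul1r.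
    by rewrite sign_of_mul_sgn_val ?ltr01.
  - by rewrite block_mxEdr; move/matrixP/(_ i2 j2): PC_C; rewrite !mxE.
by rewrite -/(real_root_count _) AE real_root_count_mulXn // addKn.
Qed.

Lemma leaf_zero n (P : sign_pattern n) (u w j : 'I_n) :
  zero_diagonal P -> leaf P u -> edge P u w -> j != w -> P u j = Zero.
Proof.
move=> P0 /eqP/cards1P[z zE] uw jw; apply/eqP; apply: contraNT jw => Puj.
have inz i : edge P u i -> i = z by move=> ui; apply/set1P; rewrite -zE inE.
rewrite (inz w uw) (inz j) // /edge Puj andbT.
by apply: contraNneq Puj => ->; rewrite P0.
Qed.

Lemma opposite_leaves_inconsistent (R : realType) (n : nat) (P : sign_pattern n)
    (u v w : 'I_n) :
  combinatorially_symmetric P -> zero_diagonal P -> u != v ->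
  leaf P u -> leaf P v -> edge P u w -> edge P v w ->
  edge_sign P u w = Plus -> edge_sign P v w = Minus -> ~ consistent R P.
Proof.
move=> Psym P0 uv lu lv uw vw Pu Pv.
have [uNw vNw] : u != w /\ v != w by move: uw vw => /andP[-> _] /andP[-> _].
(* Three distinct vertices force [n >= 3]. *)
have [m En] : exists m, n = (2 + (1 + m))%N.
  exists (n - 3)%N; have := max_card [set u; v; w].
  by rewrite finset.setUC cardsU1 cards2 !inE negb_or uv ![w == _]eq_sym uNw vNw card_ord; lia.
subst n; pose u0 := lshift (1 + m) (0 : 'I_2); pose v0 := lshift (1 + m) (1 : 'I_2).
pose w0 := rshift 2 (lshift m (0 : 'I_1)).
have [||| s [su sv sw]] := @exists_perm3 _ u0 v0 w0 u v w _ _ _ uv uNw vNw; try by [].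
move=> /(consistent_row_col_perm s); apply: inconsistent_opposite_leaves.
- by move=> i j; rewrite !mxE; exact: Psym.
- by move=> i; rewrite !mxE; exact: P0.
- move=> i j jw; rewrite !mxE.
  have sjw : s j != w by rewrite -sw (inj_eq perm_inj).
  have [->|->] : i = 0 \/ i = 1; first by case: i => -[|[|//]] lt; [left|right]; apply/val_inj.
  by rewrite -/u0 su (leaf_zero P0 lu uw).
  by rewrite -/v0 sv (leaf_zero P0 lv vw).
- by rewrite /edge_sign !mxE -/u0 -/w0 su sw.
- by rewrite /edge_sign !mxE -/v0 -/w0 sv sw.
Qed.

Theorem theorem3p14 (R : realType) (n : nat) (P : sign_pattern n)
    (P_irr : irreducible P) (P_sym : combinatorially_symmetric P)
    (P_diag0 : zero_diagonal P) (u v w : 'I_n) (u_neq_v : u <> v)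
    (u_leaf : leaf P u) (v_leaf : leaf P v)
    (uw_edge : edge P u w) (vw_edge : edge P v w) :
  consistent R P -> edge_sign P u w = edge_sign P v w.
Proof.
move=> cP; have uv : u != v by apply/eqP.
have vu : v != u by rewrite eq_sym.
(* Combinatorial symmetry makes both entries of an edge nonzero, so distinct edge signs are
   opposite; exchanging [u] and [v] covers both orders. *)
have edgeN z : edge P z w -> edge_sign P z w <> Zero.
  move=> /andP[_ /eqP zw]; have /P_sym := zw; move: zw; rewrite /edge_sign.
  by case: (P z w) => //; case: (P w z).
have := edgeN u uw_edge; have := edgeN v vw_edge.
case Pu: (edge_sign P u w); case Pv: (edge_sign P v w) => // _ _; exfalso.
  exact: (opposite_leaves_inconsistent P_sym P_diag0 uv u_leaf v_leaf uw_edge vw_edge Pu Pv cP).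
exact: (opposite_leaves_inconsistent P_sym P_diag0 vu v_leaf u_leaf vw_edge uw_edge Pv Pu cP).
Qed.
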